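(* Let $\mathbf G$ be a split semisimple group and $Q$ a fixed Weyl-invariant integer-valued quadratic form on its cocharacter lattice $Y$. Then there exists a number $c:=c(\mathbf G,Q)\in\mathbf N$ such that $$\overline G_{Q,n}^\vee\simeq\overline G_{Q,n+c}^\vee$$ for all $n$.
   Context: $\mathbf N$ is the set of positive integers. $(X,\Phi,\Delta;Y,\Phi^\vee,\Delta^\vee)$ is the root datum of $\mathbf G$. $B_Q(x,y)=Q(x+y)-Q(x)-Q(y)$. For $n\ge1$: $Y_{Q,n}=\{y\in Y:B_Q(y,y')\in n\mathbf Z\ \forall y'\in Y\}$, $n_\alpha=n/\gcd(n,Q(\alpha^\vee))$, $\alpha_{Q,n}^\vee=n_\alpha\alpha^\vee$, $\alpha_{Q,n}=\alpha/n_\alpha$, $X_{Q,n}=\mathrm{Hom}_{\mathbf Z}(Y_{Q,n},\mathbf Z)$. The dual group $\overline G_{Q,n}^\vee$ (of an $n$-fold Brylinski–Deligne cover of $\mathbf G$ attached to $Q$) is the complex reductive group with root datum $(Y_{Q,n},\{\alpha_{Q,n}^\vee\};X_{Q,n},\{\alpha_{Q,n}\})$, where $Y_{Q,n}$ is the character lattice and the $\alpha_{Q,n}^\vee$ ($\alpha\in\Phi$) are the roots, with simple roots $\alpha_{Q,n}^\vee$, $\alpha\in\Delta$. *)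

(* Defs.v *)
From HB Require Import structures.
From mathcomp Require Import all_boot all_order all_algebra.
From mathcomp Require Import boolp functions reals zify ring.
From mathcomp Require Export complex.

Set Implicit Arguments.
Unset Strict Implicit.
Unset Printing Implicit Defensive.

Import Order.TTheory GRing.Theory Num.Theory.
Local Open Scope ring_scope.

(** * Based root data *)

(** The bijection Phi -> Phi^vee, alpha |-> alpha^vee, is encoded by a common
    finite index type for roots and coroots; [simple] lists the indices of the
    simple roots.  This record only holds the data; the axioms are in
    [root_datum_axioms]. *)
Record root_data := RootData {
  char_lattice : zmodType;
  cochar_lattice : zmodType;
  pairing : char_lattice -> cochar_lattice -> int;
  root_index : finType;
  root : root_index -> char_lattice;
  coroot : root_index -> cochar_lattice;
  simple_index : finType;
  simple : simple_index -> root_index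
}.

Definition free_of_finite_rank (L : zmodType) : Prop :=
  exists (r : nat) (f : {additive L -> 'rV[int]_r}), bijective f.

Section RootDatum.
Variable D : root_data.
Local Notation X := (char_lattice D).
Local Notation Y := (cochar_lattice D).
Local Notation "<< x , y >>" := (pairing (x : X) (y : Y)).

Definition reflection (k : root_index D) (x : X) : X :=
  x - root k *~ << x, coroot k >>.

Definition coreflection (k : root_index D) (y : Y) : Y :=
  y - coroot k *~ << root k, y >>.

Definition perfect_pairing : Prop :=
  [/\ forall x x' y, << x + x', y >> = << x, y >> + << x', y >>,
      forall x y y', << x, y + y' >> = << x, y >> + << x, y' >>,
      forall f : {additive Y -> int}, exists! x, forall y, << x, y >> = f y
    & forall f : {additive X -> int}, exists! y, forall x, << x, y >> = f x].

(** The last three fields: the root system is reduced (as is the case for a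
    split group), and [simple] enumerates a base of it. *)
Record root_datum_axioms : Prop := {
  char_free : free_of_finite_rank X;
  cochar_free : free_of_finite_rank Y;
  pairing_perfect : perfect_pairing;
  root_inj : injective (@root D);
  coroot_inj : injective (@coroot D);
  root_coroot : forall k, << root k, coroot k >> = 2;
  reflection_root : forall k l, exists m, reflection k (root l) = root m;
  coreflection_coroot :
    forall k l, exists m, coreflection k (coroot l) = coroot m;
  roots_reduced : forall (k l : root_index D) (a b : int), b != 0 ->
    root l *~ b = root k *~ a -> root l = root k \/ root l = - root k;
  simple_free : forall c : simple_index D -> int,
    \sum_i root (simple i) *~ c i = 0 -> forall i, c i = 0;
  simple_base : forall k, exists c : simple_index D -> nat,
    root k = \sum_i root (simple i) *+ c i \/
    root k = - \sum_i root (simple i) *+ c i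
}.

End RootDatum.

Record root_datum := RootDatum {
  root_datum_data :> root_data;
  root_datumP : root_datum_axioms root_datum_data
}.

(** Phi spans X (x) Q. *)
Definition semisimple (D : root_data) : Prop :=
  forall x : char_lattice D, exists (m : nat) (c : root_index D -> int),
    (0 < m)%N /\ x *+ m = \sum_k root k *~ c k.

(** * Weyl-invariant quadratic forms on the cocharacter lattice *)

(** The elements of the Weyl group are the products of reflections; a word [w]
    in the roots stands for the corresponding product. *)
Definition weyl_act (D : root_data) (w : seq (root_index D))
    (y : cochar_lattice D) : cochar_lattice D :=
  foldr (@coreflection D) y w.

Definition polar (Y : zmodType) (Q : Y -> int) (x y : Y) : int :=
  Q (x + y) - Q x - Q y.

Record weyl_quadratic_form (D : root_datum) := WeylQuadraticForm {
  form :> cochar_lattice D -> int;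
  form_scale : forall (a : int) y, form (y *~ a) = a ^+ 2 * form y;
  form_polarDl : forall x x' y,
    polar form (x + x') y = polar form x y + polar form x' y;
  form_weyl : forall w y, form (weyl_act w y) = form y
}.

Section Forms.
Variables (D : root_datum) (Q : weyl_quadratic_form D).
Local Notation X := (char_lattice D).
Local Notation Y := (cochar_lattice D).
Local Notation B := (polar Q).

Lemma polarC x y : B x y = B y x.
Proof. by rewrite /polar [x + y]addrC addrAC. Qed.

Lemma polar_zmod_morphism y : zmod_morphism (B^~ y).
Proof.
by move=> x x' /=; apply: (addIr (B x' y)); rewrite -form_polarDl !subrK.
Qed.

Definition polar_additive y : {additive Y -> int} :=
  HB.pack (B^~ y) (GRing.isZmodMorphism.Build Y int _ (polar_zmod_morphism y)).

Lemma pairing_zmod_morphism (x : X) : zmod_morphism (pairing x).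
Proof.
case: (pairing_perfect (root_datumP D)) => _ pD _ _ y y' /=.
by apply: (addIr (pairing x y')); rewrite -pD !subrK.
Qed.

(** B_Q(y, alpha^vee) = Q(alpha^vee) <alpha, y>, by Weyl invariance. *)
Lemma polar_coroot (k : root_index D) (y : Y) :
  B y (coroot k) = Q (coroot k) * pairing (root k) y.
Proof.
set a := coroot k; set p := pairing (root k).
have Baa : B a a = 2 * Q a.
  rewrite /polar -[a + a]/(a *+ 2) -[a *+ 2]/(a *~ 2) form_scale.
  by ring.
have BMz z t (c : int) : B (z *~ c) t = c * B z t.
  by have := raddfMz (polar_additive t) c z; rewrite /= -mulrzl intz.
have BB z z' t : B (z - z') t = B z t - B z' t by exact: polar_zmod_morphism.
have key z : p z * B z a = p z ^+ 2 * Q a.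
  have := form_weyl Q [:: k] z; rewrite /= /coreflection -/a -/p.
  set c := p z => Qz.
  have : B (z - a *~ c) (a *~ c) = Q z - Q (z - a *~ c) - Q (a *~ c).
    by rewrite /polar subrK.
  rewrite Qz subrr add0r form_scale BB ![B _ (a *~ c)]polarC !BMz.
  rewrite [B a (_ *~ _)]polarC BMz Baa [B a z]polarC => h.
  by apply: (addIr (- (c * (c * (2 * Q a))))); rewrite h; ring.
have pD : p (y + a) = p y + p a.
  by case: (pairing_perfect (root_datumP D)) => _ /(_ (root k) y a).
have [p0|pn0] := eqVneq (p y) 0; last first.
  by apply: (mulfI pn0); rewrite key; ring.
have pa : p a = 2 by exact: (root_coroot (root_datumP D)).
have := key (y + a); rewrite pD p0 add0r pa form_polarDl Baa mulr0 expr2.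
lia.
Qed.

End Forms.

(** * The root datum of the dual group *)

(** Hom(L, Z), as a Z-module. *)
Definition additive_functions (L : zmodType) : {pred L -> int} :=
  fun f => `[< zmod_morphism f >].

Fact additive_functions_closed (L : zmodType) :
  zmod_closed (@additive_functions L).
Proof.
split=> [|f g /asboolP fA /asboolP gA]; apply/asboolP.
  by move=> x y; rewrite subrr.
move=> x y; rewrite -[LHS]/(f (x - y) - g (x - y)) fA gA.
rewrite -[RHS]/((f x - g x) - (f y - g y)).
by rewrite !opprD !opprK addrACA.
Qed.

HB.instance Definition _ (L : zmodType) :=
  GRing.isZmodClosed.Build (L -> int) (@additive_functions L)
    (additive_functions_closed L).

Record zdual (L : zmodType) := ZDual {
  zdual_fun :> L -> int;
  zdualP : zdual_fun \in @additive_functions L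
}.

HB.instance Definition _ (L : zmodType) := [isSub for @zdual_fun L].
HB.instance Definition _ (L : zmodType) := [Choice of zdual L by <:].
HB.instance Definition _ (L : zmodType) :=
  [SubChoice_isSubZmodule of zdual L by <:].

Section Dual.
Variables (D : root_datum) (Q : weyl_quadratic_form D) (n : nat).
Local Notation Y := (cochar_lattice D).

Definition YQn_pred : {pred Y} :=
  fun y => `[< forall y', (n%:Z %| polar Q y y')%Z >].

Fact YQn_closed : zmod_closed YQn_pred.
Proof.
split=> [|x y /asboolP xP /asboolP yP]; apply/asboolP => z.
  by have /= -> := raddf0 (polar_additive Q z); rewrite dvdz0.
by have /= -> := raddfB (polar_additive Q z) x y; rewrite rpredB.
Qed.

HB.instance Definition _ := GRing.isZmodClosed.Build Y YQn_pred YQn_closed.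

Record YQn := MkYQn { YQn_val :> Y; YQnP : YQn_val \in YQn_pred }.

HB.instance Definition _ := [isSub for YQn_val].
HB.instance Definition _ := [Choice of YQn by <:].
HB.instance Definition _ := [SubChoice_isSubZmodule of YQn by <:].

(** n_alpha *)
Definition n_root (k : root_index D) : nat :=
  (n %/ gcdn n `|Q (coroot k)|)%N.

Fact dual_root_subproof k : coroot k *+ n_root k \in YQn_pred.
Proof.
apply/asboolP => y.
have /= -> := raddfMn (polar_additive Q y) (n_root k) (coroot k).
rewrite polarC polar_coroot -mulr_natl natz mulrA dvdz_mulr //.
rewrite dvdzE abszM /= /n_root.
by rewrite mulnC -muln_divCA_gcd dvdn_mulr.
Qed.

(** alpha_{Q,n}^vee, an element of Y_{Q,n} *)
Definition dual_root (k : root_index D) : YQn := MkYQn (dual_root_subproof k).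

Fact dvd_n_root k (y : YQn) : (0 < n)%N ->
  ((n_root k)%:Z %| pairing (root k) (YQn_val y))%Z.
Proof.
move=> n_gt0; have /asboolP/(_ (coroot k)) := YQnP y.
rewrite polar_coroot !dvdzE abszM /= /n_root.
set q := `|_|%N; set p := `|_|%N; set g := gcdn n q.
have g_gt0 : (0 < g)%N by rewrite gcdn_gt0 n_gt0.
have gn : (g %| n)%N := dvdn_gcdl n q.
have gq : (g %| q)%N := dvdn_gcdr n q.
rewrite -{1}(divnK gn) -{1}(divnK gq) mulnAC dvdn_pmul2r //.
rewrite Gauss_dvdr // /coprime -(eqn_pmul2r g_gt0) mul1n.
by rewrite muln_gcdl !divnK.
Qed.

(** For n = 0 the quotient below is 0 by convention; otherwise it is exact
    by [dvd_n_root]. *)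
Fact dual_coroot_subproof k :
  (fun y : YQn => (pairing (root k) (YQn_val y) %/ (n_root k)%:Z)%Z)
    \in @additive_functions YQn.
Proof.
apply/asboolP => x y.
set d := (n_root k)%:Z; have [d0|d_neq0] := eqVneq d 0.
  by rewrite d0 !divz0 subr0.
have n_gt0 : (0 < n)%N.
  by rewrite lt0n; apply: contraNneq d_neq0 => n0; rewrite /d /n_root n0 div0n.
apply: (mulIf d_neq0); rewrite mulrBl !divzK ?dvd_n_root //.
exact: pairing_zmod_morphism.
Qed.

(** alpha_{Q,n} = alpha / n_alpha, an element of Hom(Y_{Q,n}, Z) *)
Definition dual_coroot (k : root_index D) : zdual YQn :=
  ZDual (dual_coroot_subproof k).

Definition dual_root_data : root_data := {|
  char_lattice := YQn;
  cochar_lattice := zdual YQn;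
  pairing := fun y f => f y;
  root_index := root_index D;
  root := dual_root;
  coroot := dual_coroot;
  simple_index := simple_index D;
  simple := @simple D
|}.

End Dual.

(** * The complex reductive group with a given root datum *)

(** An algebraic group over an algebraically closed field [K], in the classical
    language of varieties: the group of its [K]-points, together with the
    [K]-valued functions on it that are regular. *)
Record alg_group (K : Type) := AlgGroup {
  points : Type;
  group_mul : points -> points -> points;
  regular : (points -> K) -> Prop
}.

Definition alg_group_isom (K : Type) (G H : alg_group K) : Prop :=
  exists f : points G -> points H,
    [/\ bijective f,
        forall x y, f (group_mul x y) = group_mul (f x) (f y)
      & forall phi : points H -> K, regular phi <-> regular (phi \o f)].

Section ReductiveGroup.
Variables (K : fieldType) (D : root_data).
Local Notation X := (char_lattice D).

(** The reductive group with root datum [D], for [K] algebraically closed of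
    characteristic 0, by Chevalley's construction, carried out in all rational
    representations at once.

    In a basis of weight vectors, a rational representation of that group is
    the following: weights in X for the basis vectors, and matrices e_i, f_i
    (acting on column vectors) for the simple root vectors, with
    e_i V_lambda <= V_(lambda + alpha_i), f_i V_lambda <= V_(lambda - alpha_i)
    and [e_i, f_j] = delta_ij alpha_i^vee.  The Serre relations hold
    automatically in finite dimension. *)
Record rat_rep := RatRep {
  rep_dim : nat;
  weight : 'I_rep_dim -> X;
  rep_e : simple_index D -> 'M[K]_rep_dim;
  rep_f : simple_index D -> 'M[K]_rep_dim;
  rep_e_weight : forall i p q,
    rep_e i p q != 0 -> weight p = weight q + root (simple i);
  rep_f_weight : forall i p q,
    rep_f i p q != 0 -> weight p = weight q - root (simple i);
  rep_comm : forall i j,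
    rep_e i *m rep_f j - rep_f j *m rep_e i =
    if i == j then
      diag_mx (\row_p (pairing (weight p) (coroot (simple i)))%:~R)
    else 0
}.

(** The exponential of a nilpotent [d] x [d] matrix. *)
Definition nilp_exp (d : nat) (A : 'M[K]_d) : 'M[K]_d :=
  \sum_(k < d) (k`!%:R)^-1 *: A ^+ k.

(** [reductive_elt g]: the family [g] is in the subgroup of \prod_V GL(V)
    generated by the maximal torus Hom(X, K^* ) and by the root subgroups
    exp (t e_i), exp (t f_i) of the simple roots and their opposites. *)
Inductive reductive_elt : (forall V : rat_rep, 'M[K]_(rep_dim V)) -> Prop :=
| elt_torus (chi : X -> K) :
    (forall x, chi x != 0) -> (forall x y, chi (x + y) = chi x * chi y) ->
    reductive_elt (fun V => diag_mx (\row_p chi (weight p)))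
| elt_e i (t : K) : reductive_elt (fun V => nilp_exp (t *: rep_e V i))
| elt_f i (t : K) : reductive_elt (fun V => nilp_exp (t *: rep_f V i))
| elt_mul g h : reductive_elt g -> reductive_elt h ->
    reductive_elt (fun V => g V *m h V)
| elt_inv g : reductive_elt g -> reductive_elt (fun V => invmx (g V)).

Definition reductive_points : Type :=
  {g : forall V : rat_rep, 'M[K]_(rep_dim V) | reductive_elt g}.

Definition reductive_mul (x y : reductive_points) : reductive_points :=
  exist _ _ (elt_mul (svalP x) (svalP y)).

(** The regular functions on a linear algebraic group are the matrix
    coefficients of its rational representations. *)
Definition matrix_coefficient (phi : reductive_points -> K) : Prop :=
  exists (V : rat_rep) (u : 'rV[K]_(rep_dim V)) (v : 'cV[K]_(rep_dim V)),
    forall x, phi x = (u *m sval x V *m v) 0 0.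

Definition reductive_group : alg_group K :=
  AlgGroup reductive_mul matrix_coefficient.

End ReductiveGroup.

Definition dual_group (R : realType) (D : root_datum)
    (Q : weyl_quadratic_form D) (n : nat) : alg_group R[i] :=
  reductive_group R[i] (dual_root_data Q n).

(* Main.v *)
Require Import Defs.
From HB Require Import structures.
From mathcomp Require Import all_boot all_order all_algebra.
From mathcomp Require Import boolp reals ring.
Import Defs.

Set Implicit Arguments.
Unset Strict Implicit.
Unset Printing Implicit Defensive.

Import Order.TTheory GRing.Theory Num.Theory.
Local Open Scope ring_scope.

(** The group with a given based root datum depends only on the isomorphism
    class of that datum, so it is enough to find [c] such that the dual root
    data at [n] and [n + c] are isomorphic for every [n > 0].

    Put n' = n + c.  Each coroot with Q(alpha^vee) <> 0 is orthogonal, for the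
    pairing with roots, to each one with Q(alpha^vee) = 0
    ([pairing_coroot_radical]).  Hence the rational vector space generated by Y
    is the direct sum of V1 and V0, spanned by the coroots of the first and of
    the second kind; V0 is the radical of B_Q, and B_Q is nondegenerate on V1.
    If all the nonzero Q(alpha^vee) divide c, then n'_alpha / n_alpha is n' / n
    on V1, and n_alpha = n'_alpha = 1 on V0. The isomorphism must therefore be
    the identity on V0 and multiplication by n' / n on V1. Since the roots span
    X rationally, this map is characterised by its pairings with the roots; the
    relation [rescaled] expresses this by equations between integers.

    The one delicate point is that the map sends Y_{Q,n} into Y, as Y need not
    be the sum of its intersections with V0 and V1.  Now y goes to
    y + (c / n) y_1, where y_1 is the V1-component of y, so we need
    c y_1 in n Y.  For y in Y_{Q,n}, n divides
    B_Q(y, alpha^vee) = Q(alpha^vee) <alpha, y>, so it divides <alpha, y_1> up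
    to a factor independent of y and n, hence <x, y_1> for all x in X up to a
    further such factor because the roots span a subgroup of finite index; the
    pairing being perfect, these factors give c ([rescaled_exists]).  The
    inverse map is the one with n and n' exchanged.

    That the coroots span a subgroup of finite index too is deduced from the
    same statement for the roots by means of the Weyl-invariant form
    \sum_alpha <alpha, y>^2, which is positive on coroots. *)

(** * The perfect pairing *)

Section PairingTheory.
Variable D : root_datum.
Local Notation X := (char_lattice D).
Local Notation Y := (cochar_lattice D).
Local Notation "<< x , y >>" := (pairing (x : X) (y : Y)).

Lemma pairing_zmod_morphisml (y : Y) : zmod_morphism (@pairing D ^~ y).
Proof.
case: (pairing_perfect (root_datumP D)) => pD _ _ _ x x' /=.
by apply: (addIr << x', y >>); rewrite -pD !subrK.
Qed.

Definition pairingl (y : Y) : {additive X -> int} :=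
  HB.pack (@pairing D ^~ y)
    (GRing.isZmodMorphism.Build X int _ (pairing_zmod_morphisml y)).

Definition pairingr (x : X) : {additive Y -> int} :=
  HB.pack (pairing x)
    (GRing.isZmodMorphism.Build Y int _ (pairing_zmod_morphism x)).

Lemma pairingBl x x' y : << x - x', y >> = << x, y >> - << x', y >>.
Proof. exact: (raddfB (pairingl y)). Qed.

Lemma pairingMzl x y (c : int) : << x *~ c, y >> = c * << x, y >>.
Proof. by have /= -> := raddfMz (pairingl y) c x; rewrite -mulrzl intz. Qed.

Lemma pairingMnl x y (m : nat) : << x *+ m, y >> = m%:Z * << x, y >>.
Proof. by have := pairingMzl x y m. Qed.

Lemma pairing_suml (I : finType) (F : I -> X) y :
  << \sum_i F i, y >> = \sum_i << F i, y >>.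
Proof. exact: (raddf_sum (pairingl y)). Qed.

Lemma pairingDr x y y' : << x, y + y' >> = << x, y >> + << x, y' >>.
Proof. exact: (raddfD (pairingr x)). Qed.

Lemma pairingBr x y y' : << x, y - y' >> = << x, y >> - << x, y' >>.
Proof. exact: (raddfB (pairingr x)). Qed.

Lemma pairingMzr x y (c : int) : << x, y *~ c >> = c * << x, y >>.
Proof. by have /= -> := raddfMz (pairingr x) c y; rewrite -mulrzl intz. Qed.

Lemma pairingMnr x y (m : nat) : << x, y *+ m >> = m%:Z * << x, y >>.
Proof. by have := pairingMzr x y m. Qed.

Lemma pairing_sumr (I : finType) x (F : I -> Y) :
  << x, \sum_i F i >> = \sum_i << x, F i >>.
Proof. exact: (raddf_sum (pairingr x)). Qed.

Lemma pairing_injr y y' : (forall x, << x, y >> = << x, y' >>) -> y = y'.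
Proof.
move=> eq_yy'; case: (pairing_perfect (root_datumP D)) => _ _ _.
case/(_ (pairingl y)) => z [_ zU].
by rewrite -(zU y) // -(zU y') // => x; rewrite -eq_yy'.
Qed.

(** By perfectness Y is all of Hom(X, Z), so an element of Y whose pairings are
    all divisible by [n] is itself divisible by [n]. *)
Lemma pairing_divr (n : int) (y : Y) :
  n != 0 -> (forall x, (n %| << x, y >>)%Z) ->
  exists w, forall x, n * << x, w >> = << x, y >>.
Proof.
move=> n0 dvd_n.
have quot_morph : zmod_morphism (fun x => (<< x, y >> %/ n)%Z).
  move=> x x' /=; apply: (mulIf n0); rewrite mulrBl !divzK //.
  exact: pairing_zmod_morphisml.
pose quot : {additive X -> int} :=
  HB.pack (fun x => (<< x, y >> %/ n)%Z)
    (GRing.isZmodMorphism.Build X int _ quot_morph).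
case: (pairing_perfect (root_datumP D)) => _ _ _ /(_ quot) [w [wP _]].
by exists w => x; rewrite wP /= mulrC divzK.
Qed.

End PairingTheory.

(** * An invariant form that is positive on coroots *)

(** Both sides are B_Q(alpha_k^vee, alpha_l^vee). *)
Lemma polar_coroot_sym (D : root_datum) (Q : weyl_quadratic_form D)
    (k l : root_index D) :
  Q (coroot k) * pairing (root k) (coroot l) =
  Q (coroot l) * pairing (root l) (coroot k).
Proof. by rewrite -!polar_coroot polarC. Qed.

Section Killing.
Variable D : root_datum.
Local Notation X := (char_lattice D).
Local Notation Y := (cochar_lattice D).
Local Notation "<< x , y >>" := (pairing (x : X) (y : Y)).

Lemma pairing_coreflection k x y :
  << x, coreflection k y >> = << reflection k x, y >>.
Proof. by rewrite pairingBr pairingBl pairingMzr pairingMzl mulrC. Qed.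

Lemma reflectionK k : involutive (@reflection D k).
Proof.
move=> x; rewrite /reflection pairingBl pairingMzl.
rewrite (root_coroot (root_datumP D)).
set p := << _, _ >>; have -> : p - p * 2 = - p by ring.
by rewrite mulrNz opprK subrK.
Qed.

(** The quadratic form of the Killing form, Y being seen inside the Lie algebra
    of the maximal torus. *)
Definition killing (y : Y) : int := \sum_k << root k, y >> ^+ 2.

Lemma killing_scale (a : int) y : killing (y *~ a) = a ^+ 2 * killing y.
Proof.
by rewrite mulr_sumr; apply: eq_bigr => k _; rewrite pairingMzr exprMn.
Qed.

Lemma killing_polar x y :
  polar killing x y = 2 * \sum_k << root k, x >> * << root k, y >>.
Proof.
rewrite /polar /killing mulr_sumr -!sumrB; apply: eq_bigr => k _.
by rewrite pairingDr; ring.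
Qed.

Lemma killing_polarDl x x' y :
  polar killing (x + x') y = polar killing x y + polar killing x' y.
Proof.
rewrite !killing_polar -mulrDr -big_split; congr (_ * _).
by apply: eq_bigr => k _; rewrite pairingDr mulrDl.
Qed.

(** Each reflection permutes the roots. *)
Lemma killing_weyl w y : killing (weyl_act w y) = killing y.
Proof.
elim: w => //= k w <-; set z := weyl_act w y.
have [s sP] := choice (reflection_root (root_datumP D) k).
have s_inj : injective s.
  move=> l l' eq_s; apply: (root_inj (root_datumP D)).
  by apply: (can_inj (@reflectionK k)); rewrite !sP eq_s.
rewrite {2}/killing (reindex_inj s_inj); apply: eq_bigr => l _.
by rewrite pairing_coreflection sP.
Qed.

Definition killing_form : weyl_quadratic_form D :=
  WeylQuadraticForm killing_scale killing_polarDl killing_weyl.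

Lemma killing_coroot_gt0 k : 0 < killing (coroot k).
Proof.
rewrite /killing (bigD1 k) //= (root_coroot (root_datumP D)).
by apply: ltr_wpDr => //; apply: sumr_ge0 => l _; apply: sqr_ge0.
Qed.

(** [killing_form] is nonzero on every coroot, so [polar_coroot_sym] for it
    makes orthogonality of a root and a coroot symmetric. *)
Lemma pairing_coroot_eq0 k l :
  << root k, coroot l >> = 0 -> << root l, coroot k >> = 0.
Proof.
move=> kl0; have /eqP := polar_coroot_sym killing_form k l.
by rewrite kl0 mulr0 eq_sym mulf_eq0 gt_eqF ?killing_coroot_gt0 //= => /eqP.
Qed.

End Killing.

(** * Roots and coroots span subgroups of finite index *)

Section Spanning.
Variables (D : root_datum) (Dss : semisimple D).
Local Notation X := (char_lattice D).
Local Notation Y := (cochar_lattice D).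
Local Notation "<< x , y >>" := (pairing (x : X) (y : Y)).

(** Semisimplicity gives a multiplier for each character; multiplying those of
    a basis of X makes it uniform. *)
Lemma roots_span : exists m : nat, (0 < m)%N /\
  forall x : X, exists c : root_index D -> int,
    x *+ m = \sum_k root k *~ c k.
Proof.
have [r [f [g fK gK]]] := char_free (root_datumP D).
have gA : zmod_morphism g.
  by move=> u v; apply: (can_inj fK); rewrite raddfB !gK.
pose gadd : {additive 'rV[int]_r -> X} :=
  HB.pack g (GRing.isZmodMorphism.Build _ _ _ gA).
pose b i := g (delta_mx 0 i).
have bP i : exists mc : nat * (root_index D -> int),
  (0 < mc.1)%N /\ b i *+ mc.1 = \sum_k root k *~ mc.2 k.
  by have [m [c ?]] := Dss (b i); exists (m, c).
have [mc mcP] := choice bP.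
pose m := (\prod_i (mc i).1)%N.
exists m; split=> [|x].
  by rewrite prodn_gt0 // => i; case: (mcP i).
have xE : x = \sum_i b i *~ f x 0 i.
  rewrite -[LHS]fK {1}[f x]row_sum_delta -[g _]/(gadd _) raddf_sum.
  by apply: eq_bigr => i _; rewrite -{1}[f x 0 i]intz scaler_int raddfMz.
pose q i := (m %/ (mc i).1)%N.
have mE i : m = ((mc i).1 * q i)%N.
  by rewrite mulnC divnK // /m (bigD1 i) //= dvdn_mulr.
exists (fun k => \sum_i (mc i).2 k * (q i)%:Z * f x 0 i).
under eq_bigr => k _ do rewrite mulrz_sumr.
rewrite exchange_big {1}xE -sumrMnl; apply: eq_bigr => i _ /=.
rewrite -[LHS]/(b i *~ f x 0 i *~ m) mulrzAC -pmulrn (mE i) mulrnA.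
have [_ ->] := mcP i; rewrite !pmulrn !mulrz_suml.
by apply: eq_bigr => k _; rewrite !mulrzA.
Qed.

Lemma eq_pairing_roots y y' :
  (forall k, << root k, y >> = << root k, y' >>) -> y = y'.
Proof.
move=> eq_roots; have [m [m_gt0 span]] := roots_span.
apply: pairing_injr => x; have [c xE] := span x.
have m_neq0 : m%:Z != 0 by rewrite -lt0n.
apply: (mulfI m_neq0); rewrite -!pairingMnl xE !pairing_suml.
by apply: eq_bigr => k _; rewrite !pairingMzl eq_roots.
Qed.

(** Write (.,.) for the polar form of [killing].  Clearing denominators in
    (alpha^vee, .) = killing(alpha^vee) alpha, any expression of (y, .) through
    the roots, which [roots_span] provides, becomes one through the
    (alpha^vee, .); as (.,.) is nondegenerate, this is an expression of a
    multiple of [y] through the coroots. *)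
Lemma coroots_span : exists m : nat, (0 < m)%N /\
  forall y : Y, exists c : root_index D -> int,
    y *+ m = \sum_k coroot k *~ c k.
Proof.
have [m [m_gt0 span]] := roots_span.
pose q (k : root_index D) := `|killing (coroot k)|%N.
have qE k : killing (coroot k) = (q k)%:Z.
  by rewrite gtz0_abs ?killing_coroot_gt0.
have q_gt0 k : (0 < q k)%N by rewrite absz_gt0 gt_eqF ?killing_coroot_gt0.
pose M := (\prod_k q k)%N.
have M_gt0 : (0 < M)%N by rewrite prodn_gt0.
have ME k : M = (q k * (M %/ q k))%N.
  by rewrite mulnC divnK // /M (bigD1 k) //= dvdn_mulr.
exists (m * M)%N; split=> [|y]; first by rewrite muln_gt0 m_gt0.
(* The character by which [y] acts through the polar form. *)
pose x := (\sum_k root k *~ << root k, y >>) *+ 2.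
have xE z : << x, z >> = polar (@killing D) y z.
  rewrite killing_polar pairingMnl pairing_suml; congr (_ * _).
  by apply: eq_bigr => k _; rewrite pairingMzl.
have [c cE] := span x.
exists (fun k => c k * (M %/ q k)%:Z).
apply: eq_pairing_roots => l.
have q_neq0 : killing (coroot l) != 0 by rewrite gt_eqF ?killing_coroot_gt0.
apply: (mulfI q_neq0); rewrite pairingMnr mulrCA -(polar_coroot (killing_form D)).
rewrite -xE PoszM mulrAC -pairingMnl cE mulrC.
rewrite pairing_suml pairing_sumr !mulr_sumr; apply: eq_bigr => k _.
rewrite pairingMzl pairingMzr mulrCA -[RHS]mulrCA.
rewrite -(polar_coroot_sym (killing_form D)) /= qE {1}(ME k) PoszM.
by ring.
Qed.

End Spanning.

(** * Rescaling the part of Y on which Q is nondegenerate *)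

Section Rescaling.
Variables (D : root_datum) (Dss : semisimple D) (Q : weyl_quadratic_form D).
Local Notation X := (char_lattice D).
Local Notation Y := (cochar_lattice D).
Local Notation "<< x , y >>" := (pairing (x : X) (y : Y)).

(** [z] is the image of [y] under the rational map that is the identity on the
    radical of B_Q and multiplication by n' / n on the span of the coroots with
    Q(alpha^vee) <> 0. *)
Definition rescaled (n n' : nat) (y z : Y) : Prop :=
  forall k, n%:Z * << root k, z >> =
    (if Q (coroot k) == 0 then n else n')%:Z * << root k, y >>.

Lemma rescaled_sym n n' y z :
  (0 < n)%N -> (0 < n')%N -> rescaled n n' y z -> rescaled n' n z y.
Proof.
move=> n_gt0 n'_gt0 yz k; have := yz k; case: ifP => // _.
have n0 : n%:Z != 0 by rewrite -lt0n.
by move=> /(mulfI n0) ->.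
Qed.

Lemma rescaled_unique n n' y z z' : (0 < n)%N ->
  rescaled n n' y z -> rescaled n n' y z' -> z = z'.
Proof.
move=> n_gt0 yz yz'; have n0 : n%:Z != 0 by rewrite -lt0n.
by apply: (eq_pairing_roots Dss) => k; apply: (mulfI n0); rewrite yz yz'.
Qed.

Lemma rescaledB n n' y1 y2 z1 z2 :
  rescaled n n' y1 z1 -> rescaled n n' y2 z2 ->
  rescaled n n' (y1 - y2) (z1 - z2).
Proof. by move=> h1 h2 k; rewrite !pairingBr !mulrBr h1 h2. Qed.

Lemma pairing_coroot_radical k l :
  Q (coroot k) = 0 -> Q (coroot l) != 0 -> << root k, coroot l >> = 0.
Proof.
move=> Qk0 Ql0; apply: pairing_coroot_eq0; apply: (mulfI Ql0).
by rewrite -polar_coroot_sym Qk0 mul0r mulr0.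
Qed.

(** y_1 is [m] times the projection of [y] along the radical of B_Q: keep the
    coroots with Q(alpha^vee) <> 0 in an expression of [m] times [y]. *)
Lemma nonradical_part : exists m : nat, (0 < m)%N /\
  forall y : Y, exists y1 : Y, forall k,
    << root k, y1 >> =
      if Q (coroot k) == 0 then 0 else m%:Z * << root k, y >>.
Proof.
have [m [m_gt0 span]] := coroots_span Dss.
exists m; split=> // y; have [c cE] := span y.
exists (\sum_k coroot k *~ (if Q (coroot k) == 0 then 0 else c k)) => l.
rewrite -pairingMnr cE !pairing_sumr; case: eqVneq => Ql.
  apply: big1 => k _; rewrite pairingMzr; case: eqVneq => Qk.
    by rewrite mul0r.
  by rewrite pairing_coroot_radical ?mulr0.
apply: eq_bigr => k _; rewrite !pairingMzr; case: eqVneq => // Qk.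
by rewrite (pairing_coroot_eq0 (pairing_coroot_radical Qk Ql)) !mulr0.
Qed.

(** B_Q only sees the rescaled part.  It is enough to test this against the
    coroots, where B_Q(., alpha^vee) = Q(alpha^vee) alpha. *)
Lemma polar_rescaled n n' y z y' : rescaled n n' y z ->
  n%:Z * polar Q z y' = n'%:Z * polar Q y y'.
Proof.
move=> yz; have [m [m_gt0 span]] := coroots_span Dss; have [c cE] := span y'.
have m0 : m%:Z != 0 by rewrite -lt0n.
have expand x : m%:Z * polar Q x y' =
    \sum_k c k * (Q (coroot k) * << root k, x >>).
  have mE : m%:Z * polar Q y' x = polar Q (y' *+ m) x.
    by have /= -> := raddfMn (polar_additive Q x) m y'; rewrite -mulr_natl natz.
  rewrite polarC mE cE; have /= -> := raddf_sum (polar_additive Q x).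
  apply: eq_bigr => k _; rewrite -polar_coroot.
  have /= -> := raddfMz (polar_additive Q x) (c k) (coroot k).
  by rewrite -mulrzl intz polarC.
apply: (mulfI m0); rewrite 2!(mulrCA m%:Z) !expand !mulr_sumr.
apply: eq_bigr => k _; rewrite !(mulrCA _ (c k)) !(mulrCA _ (Q _)) yz.
by case: eqVneq => [->|//]; rewrite !mul0r.
Qed.

Definition coroot_form_prod : nat :=
  (\prod_k (if Q (coroot k) == 0 then 1 else `|Q (coroot k)|))%N.

Lemma coroot_form_prod_gt0 : (0 < coroot_form_prod)%N.
Proof.
by rewrite prodn_gt0 // => k; case: eqVneq => // Qk; rewrite absz_gt0.
Qed.

Lemma dvdz_coroot_form_prod k :
  Q (coroot k) != 0 -> (Q (coroot k) %| coroot_form_prod%:Z)%Z.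
Proof.
move=> Qk; rewrite dvdzE /= /coroot_form_prod (bigD1 k) //= (negPf Qk).
exact: dvdn_mulr.
Qed.

(** The integrality statement behind the theorem: the image of [y] is
    y + t w, where w is (N / n) times the projection of [y] along the radical.
    That w lies in Y although N is independent of [n] is due to
    B_Q(y, .) being divisible by [n]. *)
Lemma rescaled_exists : exists N : nat,
  [/\ (0 < N)%N,
      forall k, Q (coroot k) != 0 -> (Q (coroot k) %| N%:Z)%Z
    & forall (n n' : nat) y, (0 < n)%N -> (N%:Z %| n'%:Z - n%:Z)%Z ->
        y \in YQn_pred Q n ->
        exists z, z \in YQn_pred Q n' /\ rescaled n n' y z].
Proof.
have [mX [mX_gt0 spanX]] := roots_span Dss.
have [m [m_gt0 part]] := nonradical_part.
(* [m] makes the projection integral; [coroot_form_prod] and [mX] are what is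
   lost in passing from divisibility of B_Q(y, .) by n to divisibility of the
   projection. *)
exists (coroot_form_prod * (mX * m))%N.
split=> [|k Qk|n n' y n_gt0 /dvdzP[t tE] yP].
- by rewrite !muln_gt0 coroot_form_prod_gt0 mX_gt0.
- by rewrite PoszM dvdz_mulr // dvdz_coroot_form_prod.
have n0 : n%:Z != 0 by rewrite -lt0n.
have [y1 y1E] := part y.
have dvd_root k : (n%:Z %| coroot_form_prod%:Z * << root k, y1 >>)%Z.
  rewrite y1E; case: eqVneq => Qk; first by rewrite mulr0 dvdz0.
  have /dvdzP[q ->] := dvdz_coroot_form_prod Qk.
  rewrite mulrCA -mulrA dvdz_mull // dvdz_mull // -polar_coroot.
  by move/asboolP: yP; apply.
have [w wE] : exists w, forall x,
    n%:Z * << x, w >> = << x, y1 *+ (coroot_form_prod * mX) >>.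
  apply: pairing_divr => // x; have [c cE] := spanX x.
  rewrite pairingMnr PoszM -mulrA -pairingMnl cE pairing_suml mulr_sumr.
  by apply: rpred_sum => k _; rewrite pairingMzl mulrCA dvdz_mull.
have yz : rescaled n n' y (y + w *~ t).
  move=> k; rewrite pairingDr pairingMzr mulrDr mulrCA wE pairingMnr y1E.
  case: eqVneq => _; first by rewrite !mulr0 addr0.
  have -> : n'%:Z = n%:Z + t * (coroot_form_prod * (mX * m))%:Z.
    by rewrite -tE; ring.
  by rewrite !PoszM; ring.
exists (y + w *~ t); split=> //; apply/asboolP => y'.
have /dvdzP[b bE] : (n%:Z %| polar Q y y')%Z by move/asboolP: yP; apply.
apply/dvdzP; exists b; apply: (mulfI n0).
by rewrite (polar_rescaled _ yz) bE; ring.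
Qed.

(** The factors n_alpha depend on Q(alpha^vee) only through its gcd with n, so
    congruence of the two moduli enters in the form of [eq_gcd]. *)
Section CongruentModuli.
Variables n n' : nat.
Hypotheses (n_gt0 : (0 < n)%N) (n'_gt0 : (0 < n')%N).
Hypothesis eq_gcd : forall k, Q (coroot k) != 0 ->
  gcdn n `|Q (coroot k)| = gcdn n' `|Q (coroot k)|.

Lemma n_root_rescaled k :
  (n * n_root Q n' k = (if Q (coroot k) == 0 then n else n') * n_root Q n k)%N.
Proof.
rewrite /n_root; case: eqVneq => [->|Qk].
  by rewrite absz0 !gcdn0 !divnn n_gt0 n'_gt0.
rewrite (eq_gcd Qk) -{1}(divnK (dvdn_gcdl n `|Q (coroot k)|)) (eq_gcd Qk).
by rewrite -mulnA [X in (_ * X)%N]mulnC divnK ?dvdn_gcdl // mulnC.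
Qed.

(** When only one of Q(alpha_k^vee), Q(alpha_l^vee) vanishes the scaling factors
    on the two sides differ, but then <alpha_l, alpha_k^vee> = 0. *)
Lemma dual_root_rescaled k :
  rescaled n n' (YQn_val (dual_root Q n k)) (YQn_val (dual_root Q n' k)).
Proof.
move=> l /=; rewrite !pairingMnr !mulrA -!PoszM n_root_rescaled.
case: (eqVneq (Q (coroot k))) => Qk; case: (eqVneq (Q (coroot l))) => Ql //.
  by rewrite (pairing_coroot_eq0 (pairing_coroot_radical Qk Ql)) !mulr0.
by rewrite pairing_coroot_radical ?mulr0.
Qed.

Lemma dual_coroot_rescaled k (y : YQn Q n) (z : YQn Q n') :
  rescaled n n' (YQn_val y) (YQn_val z) ->
  dual_coroot Q n' k z = dual_coroot Q n k y.
Proof.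
move=> /(_ k) yz /=.
have nr_gt0 r : (0 < r)%N -> (0 < n_root Q r k)%N.
  by move=> r0; rewrite divn_gt0 ?gcdn_gt0 ?r0 // dvdn_leq ?dvdn_gcdl.
have /dvdzP[a aE] := dvd_n_root k y n_gt0.
have /dvdzP[b bE] := dvd_n_root k z n'_gt0.
have nr0 r : (0 < r)%N -> (n_root Q r k)%:Z != 0.
  by move=> /nr_gt0; rewrite -lt0n.
rewrite aE bE !mulzK ?nr0 //; move: yz; rewrite aE bE.
rewrite mulrCA -PoszM n_root_rescaled [RHS]mulrCA -PoszM.
by apply: mulIf; rewrite -lt0n muln_gt0 nr_gt0 // andbT; case: ifP.
Qed.

End CongruentModuli.

End Rescaling.

(** * Isomorphisms of based root data induce isomorphisms of groups *)

(** Only the simple roots and coroots are constrained, because they are all that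
    the construction of the reductive group uses. *)
Record based_iso (D1 D2 : root_data) := BasedIso {
  iso_char : char_lattice D1 -> char_lattice D2;
  iso_char_inv : char_lattice D2 -> char_lattice D1;
  iso_simple : simple_index D1 -> simple_index D2;
  iso_simple_inv : simple_index D2 -> simple_index D1;
  iso_charB : zmod_morphism iso_char;
  iso_charK : cancel iso_char iso_char_inv;
  iso_char_invK : cancel iso_char_inv iso_char;
  iso_simpleK : cancel iso_simple iso_simple_inv;
  iso_simple_invK : cancel iso_simple_inv iso_simple;
  iso_root : forall i,
    iso_char (root (simple i)) = root (simple (iso_simple i));
  iso_coroot : forall x i,
    pairing (iso_char x) (coroot (simple (iso_simple i))) =
    pairing x (coroot (simple i))
}.

Section BasedIsoInverse.
Variables (D1 D2 : root_data) (I : based_iso D1 D2).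

Fact iso_char_invB : zmod_morphism (iso_char_inv I).
Proof.
by move=> x y; apply: (can_inj (iso_charK I)); rewrite iso_charB !iso_char_invK.
Qed.

Fact iso_root_inv i :
  iso_char_inv I (root (simple i)) = root (simple (iso_simple_inv I i)).
Proof.
apply: (can_inj (iso_charK I)).
by rewrite iso_root iso_simple_invK iso_char_invK.
Qed.

Fact iso_coroot_inv x i :
  pairing (iso_char_inv I x) (coroot (simple (iso_simple_inv I i))) =
  pairing x (coroot (simple i)).
Proof. by rewrite -(iso_coroot I) iso_char_invK iso_simple_invK. Qed.

Definition based_iso_inv : based_iso D2 D1 :=
  BasedIso iso_char_invB (iso_char_invK I) (iso_charK I) (iso_simple_invK I)
    (iso_simpleK I) iso_root_inv iso_coroot_inv.

End BasedIsoInverse.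

Section TransportRep.
Variables (K : fieldType) (D1 D2 : root_data) (I : based_iso D1 D2).
Variable V : rat_rep K D1.

Let e i := rep_e V (iso_simple_inv I i).
Let f i := rep_f V (iso_simple_inv I i).
Let wt (p : 'I_(rep_dim V)) := iso_char I (weight p).

Let root_invE i :
  iso_char I (root (simple (iso_simple_inv I i))) = root (simple i).
Proof. by rewrite iso_root iso_simple_invK. Qed.

Let iso_charBE x y : iso_char I (x - y) = iso_char I x - iso_char I y.
Proof. exact: iso_charB. Qed.

Fact rep_along_e_weight i p q : e i p q != 0 -> wt p = wt q + root (simple i).
Proof.
by move=> /rep_e_weight pq; rewrite -root_invE /wt pq; apply/eqP;
  rewrite -subr_eq -iso_charBE addrK.
Qed.

Fact rep_along_f_weight i p q : f i p q != 0 -> wt p = wt q - root (simple i).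
Proof. by move=> /rep_f_weight pq; rewrite -root_invE -iso_charBE /wt pq. Qed.

Fact rep_along_comm i j :
  e i *m f j - f j *m e i =
  if i == j then
    diag_mx (\row_p (pairing (wt p) (coroot (simple i)))%:~R) else 0.
Proof.
rewrite rep_comm (can_eq (iso_simple_invK I)); case: eqP => // _.
congr diag_mx; apply/rowP => p; rewrite !mxE.
by rewrite -(iso_coroot I) iso_simple_invK.
Qed.

(** The matrices are kept, and the weights moved along the isomorphism.  The
    dimension is thus the same by computation, which lets a family of matrices
    over the representations for D1 be read over those for D2. *)
Definition rep_along : rat_rep K D2 :=
  RatRep rep_along_e_weight rep_along_f_weight rep_along_comm.

End TransportRep.

Section TransportGroup.
Variable K : fieldType.

(** Two arbitrary isomorphisms [I] and [J], and not [I] and its inverse: the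
    double inverse of [I] has the same maps as [I], but is not convertible to
    it, and both round trips have to be covered. *)
Lemma rep_alongK (D1 D2 : root_data) (I : based_iso D1 D2)
    (J : based_iso D2 D1) (g : forall V : rat_rep K D1, 'M[K]_(rep_dim V))
    (V : rat_rep K D1) :
  cancel (iso_char I) (iso_char J) ->
  cancel (iso_simple_inv J) (iso_simple_inv I) ->
  g (rep_along J (rep_along I V)) = g V.
Proof.
(* The equation is between matrices of convertible types; generalising the
   components of the record avoids a transport along equal dimensions. *)
move=> charK simpleK; case: V => d w e f ew fw ef; rewrite /rep_along /=.
have congr_rep w' e' f' ew' fw' ef' : w' = w -> e' = e -> f' = f ->
    g (@RatRep K D1 d w' e' f' ew' fw' ef') = g (RatRep ew fw ef) :> 'M[K]_d.
  move=> Ew Ee Ef; subst w' e' f'.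
  by congr (g (RatRep _ _ _)); apply: Prop_irrelevance.
by apply: congr_rep; apply: funext => x /=; rewrite ?charK ?simpleK.
Qed.

Section Points.
Variables (D1 D2 : root_data) (I : based_iso D1 D2).

Lemma reductive_elt_along (g : forall V : rat_rep K D1, 'M[K]_(rep_dim V)) :
  reductive_elt g ->
  reductive_elt (fun V : rat_rep K D2 => g (rep_along (based_iso_inv I) V)).
Proof.
elim=> [chi chi0 chiD|i t|i t|g1 g2 _ IH1 _ IH2|g1 _ IH1].
- apply: (@elt_torus K D2 (chi \o iso_char_inv I)) => [x|x y /=].
    exact: chi0.
  rewrite -chiD; congr chi; have invB := iso_char_invB I.
  by apply/eqP; rewrite -subr_eq -invB addrK.
- exact: (@elt_e K D2 (iso_simple I i) t).
- exact: (@elt_f K D2 (iso_simple I i) t).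
- exact: elt_mul IH1 IH2.
- exact: elt_inv IH1.
Qed.

Definition points_along (x : reductive_points K D1) : reductive_points K D2 :=
  exist _ _ (reductive_elt_along (svalP x)).

End Points.

Lemma reductive_points_eq (D : root_data) (x y : reductive_points K D) :
  (forall V, sval x V = sval y V) -> x = y.
Proof.
case: x y => [g gP] [h hP] /= eq_gh.
by apply: eq_exist; apply: functional_extensionality_dep.
Qed.

Lemma points_alongK (D1 D2 : root_data) (I : based_iso D1 D2) :
  cancel (@points_along D1 D2 I) (points_along (based_iso_inv I)).
Proof.
move=> x; apply: reductive_points_eq => V.
exact: (rep_alongK (I := based_iso_inv (based_iso_inv I))
  (J := based_iso_inv I) (sval x) V (iso_charK I) (iso_simpleK I)).
Qed.

Lemma points_along_invK (D1 D2 : root_data) (I : based_iso D1 D2) :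
  cancel (points_along (based_iso_inv I)) (@points_along D1 D2 I).
Proof.
move=> x; apply: reductive_points_eq => V.
exact: (rep_alongK (I := based_iso_inv I)
  (J := based_iso_inv (based_iso_inv I)) (sval x) V
  (iso_char_invK I) (iso_simple_invK I)).
Qed.

Lemma matrix_coefficient_along (D1 D2 : root_data) (I : based_iso D1 D2)
    (phi : reductive_points K D2 -> K) :
  matrix_coefficient phi -> matrix_coefficient (phi \o points_along I).
Proof.
move=> [V [u [v phiE]]].
by exists (rep_along (based_iso_inv I) V), u, v => x /=; rewrite phiE.
Qed.

Theorem reductive_group_isom (D1 D2 : root_data) (I : based_iso D1 D2) :
  alg_group_isom (reductive_group K D1) (reductive_group K D2).
Proof.
exists (points_along I); split=> [|x y|phi].
- exists (points_along (based_iso_inv I)).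
  + exact: points_alongK.
  + exact: points_along_invK.
- exact: reductive_points_eq.
- split; first exact: matrix_coefficient_along.
  move=> /(matrix_coefficient_along (based_iso_inv I)).
  congr matrix_coefficient.
  by apply: funext => x /=; rewrite points_along_invK.
Qed.

End TransportGroup.

(** * Periodicity of the dual root datum *)

Section Periodicity.
Variables (D : root_datum) (Dss : semisimple D) (Q : weyl_quadratic_form D).

(** The lattice maps in the two directions are obtained by choice from
    [rescaled_exists]; additivity, the cancellation laws and compatibility with
    the roots all come from the uniqueness of rescalings. *)
Theorem dual_root_data_periodic : exists c : nat, (0 < c)%N /\
  forall n : nat, (0 < n)%N ->
    inhabited (based_iso (dual_root_data Q n) (dual_root_data Q (n + c)%N)).
Proof.
have [c [c_gt0 dvd_c resc]] := rescaled_exists Dss Q.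
exists c; split=> // n n_gt0; set n' := (n + c)%N.
have n'_gt0 : (0 < n')%N by rewrite ltn_addr.
have eq_gcd k : Q (coroot k) != 0 ->
    gcdn n `|Q (coroot k)| = gcdn n' `|Q (coroot k)|.
  move=> /dvd_c; rewrite dvdzE /= => /dvdnP[q cE].
  by rewrite /n' cE addnC gcdnC [RHS]gcdnC gcdnMDl.
have liftP r r' : (0 < r)%N -> (c%:Z %| r'%:Z - r%:Z)%Z ->
    {phi : YQn Q r -> YQn Q r' &
      forall y, rescaled Q r r' (YQn_val y) (YQn_val (phi y))}.
  move=> r_gt0 dvd_r.
  have ex (y : YQn Q r) : exists z : YQn Q r',
      rescaled Q r r' (YQn_val y) (YQn_val z).
    have [z [zP yz]] := resc r r' (YQn_val y) r_gt0 dvd_r (YQnP y).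
    by exists (MkYQn zP).
  exact: choice ex.
have dvd_n : (c%:Z %| n'%:Z - n%:Z)%Z by rewrite /n' PoszD addrC addKr.
have dvd_n' : (c%:Z %| n%:Z - n'%:Z)%Z by rewrite -opprB rpredN.
have [phi phiP] := liftP n n' n_gt0 dvd_n.
have [psi psiP] := liftP n' n n'_gt0 dvd_n'.
have unique r r' (y : YQn Q r) (z z' : YQn Q r') : (0 < r)%N ->
    rescaled Q r r' (YQn_val y) (YQn_val z) ->
    rescaled Q r r' (YQn_val y) (YQn_val z') -> z = z'.
  move=> r_gt0 yz yz'; apply: val_inj.
  exact: (rescaled_unique Dss r_gt0 yz yz').
constructor.
apply: (@BasedIso (dual_root_data Q n) (dual_root_data Q n') phi psi id id)
  => //=.
- move=> y1 y2; apply: (unique n n' (y1 - y2)) => //.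
  exact: rescaledB (phiP y1) (phiP y2).
- move=> y; apply: (unique n' n (phi y)) => //; exact: rescaled_sym.
- move=> z; apply: (unique n n' (psi z)) => //; exact: rescaled_sym.
- move=> i; apply: (unique n n' (dual_root Q n (simple i))) => //.
  exact: dual_root_rescaled.
- move=> y i; exact: dual_coroot_rescaled.
Qed.

End Periodicity.

Theorem proposition2p13 (D : root_datum) (Dss : semisimple D)
    (Q : weyl_quadratic_form D) :
  exists c : nat, (0 < c)%N /\
    forall (R : realType) (n : nat), (0 < n)%N ->
      alg_group_isom (dual_group R Q n) (dual_group R Q (n + c)%N).
Proof.
have [c [c_gt0 iso_c]] := dual_root_data_periodic Dss Q.
exists c; split=> // R n n_gt0; have [I] := iso_c n n_gt0.
exact: reductive_group_isom.
Qed.
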